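(* Let $G$ be a finitely generated group and let $S$ be a finite generating subset. Assume that $G$ does not have the Haagerup property. Then for any nested sequence $G=N_0\trianglerighteq N_1\trianglerighteq\cdots$ of normal finite index subgroups of $G$ such that $\bigcap_{n=0}^\infty N_n=\{e\}$, the box space associated to $S$ and to $(N_n)_{n\in\mathbb{N}}$ does not coarsely embed into a Hilbert space. Moreover, if $G$ has relative Property T with respect to an infinite subset, then the box space does not coarsely embed into a Hilbert space.
   Context: Box space: given a finite generating subset $S$ of $G$ and a nested sequence of finite index normal subgroups $G=N_0\trianglerighteq N_1\trianglerighteq\cdots$ with trivial intersection, the box space is the sequence of Cayley graphs $(G/N_n,d_{S_n})$, where $S_n$ is $S$ modulo $N_n$ and $d_{S_n}$ is the word metric. Coarse embedding: a sequence of maps $\phi_n\colon X_n\to Y$ from metric spaces $(X_n,d_n)$ to a metric space $(Y,d_Y)$ is a coarse embedding of $(X_n)$ into $Y$ if there are two proper functions $\rho,\gamma\colon[0,\infty)\to[0,\infty)$ (independent of $n$) with $\rho(d_n(x,y))\leqslant d_Y(\phi_n(x),\phi_n(y))\leqslant\gamma(d_n(x,y))$ for all $n$ and all $x,y\in X_n$. Haagerup property: $G$ admits an affine isometric action $\sigma(g)v=\pi(g)v+b(g)$ on a Hilbert space ($\pi$ a norm-preserving representation, $b$ a $1$-cocycle) such that $b$ is a coarse embedding, i.e. the action is metrically proper. Relative Property T: for an infinite subset $Y\subseteq G$, the pair $(G,Y)$ has relative Property T (i.e. $G$ has relative Property T with respect to $Y$) if for every orthogonal representation $(\mathcal{H},\pi)$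 of $G$ in a Hilbert space and every sequence of unit vectors $v_n\in\mathcal{H}$ with $\|\pi(g)v_n-v_n\|\to0$ for all $g\in G$, one has $\sup_{y\in Y}\|\pi(y)v_n-v_n\|\to0$. *)

(* Defs.v *)
From HB Require Import structures.
From mathcomp Require Import all_boot all_order all_algebra.
From mathcomp Require Import sesquilinear.
From mathcomp Require Import boolp classical_sets cardinality reals.
From mathcomp Require Import topology normedtype.

Set Implicit Arguments.
Unset Strict Implicit.
Unset Printing Implicit Defensive.

Import Order.TTheory GRing.Theory Num.Theory.
Import numFieldNormedType.Exports.

Local Open Scope classical_set_scope.
Local Open Scope ring_scope.

HB.mixin Record isConjClosed (G : groupType) (N : {pred G}) := {
  gpredJr : forall x y : G, x \in N -> (x ^ y)%g \in N
}.

#[short(type="normalClosed")]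
HB.structure Definition NormalClosed (G : groupType) :=
  {N of GroupClosed G N & isConjClosed G N}.

Section quotient_group.
Context {G : groupType} (N : normalClosed G).
Local Open Scope group_scope.
Local Open Scope quotient_scope.

Definition coset_rel : rel G := fun x y => x^-1 * y \in N.

Fact coset_rel_refl : reflexive coset_rel.
Proof. by move=> x; rewrite /coset_rel mulVg gpred1. Qed.

Fact coset_rel_sym : symmetric coset_rel.
Proof.
by move=> x y; rewrite /coset_rel -gpredV invgM invgK.
Qed.

Fact coset_rel_trans : transitive coset_rel.
Proof.
move=> y x z xy yz; rewrite /coset_rel.
have -> : x^-1 * z = (x^-1 * y) * (y^-1 * z) by rewrite mulgA mulgK.
exact: gpredM.
Qed.

Canonical coset_equiv :=
  EquivRel coset_rel coset_rel_refl coset_rel_sym coset_rel_trans.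

Definition quotient_group := {eq_quot coset_equiv}.

HB.instance Definition _ := Choice.on quotient_group.
HB.instance Definition _ := EqQuotient.on quotient_group.

Definition quotient_proj (x : G) : quotient_group := \pi_quotient_group x.

Definition quotient_one : quotient_group := quotient_proj 1.
Definition quotient_mul (a b : quotient_group) : quotient_group :=
  quotient_proj (repr a * repr b).
Definition quotient_inv (a : quotient_group) : quotient_group :=
  quotient_proj (repr a)^-1.

Fact quotient_projP x y :
  reflect (quotient_proj x = quotient_proj y) (x^-1 * y \in N).
Proof.
apply: (iffP idP) => [xy|].
  by apply/eqmodP.
by move/eqmodP.
Qed.

Fact quotient_projM x y :
  quotient_mul (quotient_proj x) (quotient_proj y) = quotient_proj (x * y).
Proof.
rewrite /quotient_mul; apply/esym/quotient_projP.
have /quotient_projP xP : quotient_proj x = quotient_proj (repr (quotient_proj x)).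
  by rewrite /quotient_proj reprK.
have /quotient_projP yP : quotient_proj y = quotient_proj (repr (quotient_proj y)).
  by rewrite /quotient_proj reprK.
set x' := repr (quotient_proj x) in xP *.
set y' := repr (quotient_proj y) in yP *.
have -> : (x * y)^-1 * (x' * y') = (x^-1 * x') ^ y * (y^-1 * y').
  by rewrite /conjg invgM !mulgA mulgK.
by rewrite gpredM// gpredJr.
Qed.

Fact quotient_projV x :
  quotient_inv (quotient_proj x) = quotient_proj x^-1.
Proof.
apply/esym/quotient_projP.
have /quotient_projP : quotient_proj x = quotient_proj (repr (quotient_proj x)).
  by rewrite /quotient_proj reprK.
move: (repr _) => x' xP; rewrite -gpredV invgM !invgK.
have -> : x' * x^-1 = (x^-1 * x') ^ x^-1.
  by rewrite /conjg invgK !mulgA mulgV mul1g.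
exact: gpredJr.
Qed.

Fact quotient_proj_surj a : exists x, a = quotient_proj x.
Proof. by exists (repr a); rewrite /quotient_proj reprK. Qed.

Fact quotient_mulA : associative quotient_mul.
Proof.
move=> a b c; have [x ->] := quotient_proj_surj a.
have [y ->] := quotient_proj_surj b; have [z ->] := quotient_proj_surj c.
by rewrite !quotient_projM mulgA.
Qed.

Fact quotient_mul1g : left_id quotient_one quotient_mul.
Proof.
by move=> a; have [x ->] := quotient_proj_surj a; rewrite quotient_projM mul1g.
Qed.

Fact quotient_mulg1 : right_id quotient_one quotient_mul.
Proof.
by move=> a; have [x ->] := quotient_proj_surj a; rewrite quotient_projM mulg1.
Qed.

Fact quotient_mulVg : left_inverse quotient_one quotient_inv quotient_mul.
Proof.
move=> a; have [x ->] := quotient_proj_surj a.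
by rewrite quotient_projV quotient_projM mulVg.
Qed.

Fact quotient_mulgV : right_inverse quotient_one quotient_inv quotient_mul.
Proof.
move=> a; have [x ->] := quotient_proj_surj a.
by rewrite quotient_projV quotient_projM mulgV.
Qed.

HB.instance Definition _ := isGroup.Build quotient_group quotient_mulA
  quotient_mul1g quotient_mulg1 quotient_mulVg quotient_mulgV.

Fact quotient_proj_gmulfM : {morph quotient_proj : x y / x * y}.
Proof. by move=> x y; exact/esym/quotient_projM. Qed.

HB.instance Definition _ :=
  isUMagmaMorphism.Build G quotient_group quotient_proj
    (erefl _, quotient_proj_gmulfM).

End quotient_group.

Section word_metric.
Context {G : groupType}.
Implicit Types (S : set G) (g x y : G).

Definition words S g : set (seq G) :=
  [set w | (forall s, s \in w -> S s \/ S s^-1%g) /\ (\prod_(s <- w) s)%g = g].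

Definition generates S := forall g, words S g !=set0.

(* The infimum is a minimum when g is a product of elements of S and of their
   inverses; otherwise it has the junk value inf set0 = 0. *)
Definition word_length (R : realType) S g : R :=
  inf [set (size w)%:R | w in words S g].

(* The path metric of the Cayley graph with edges {x, x s}, s in S. *)
Definition word_metric (R : realType) S x y : R :=
  word_length R S (x^-1 * y)%g.

End word_metric.

Section box_space.
Context {G : groupType}.

Definition box_filtration (N : nat -> normalClosed G) : Prop :=
  [/\ N 0 =i predT,
      forall n, {subset N n.+1 <= N n},
      forall n, finite_set [set: quotient_group (N n)] &
      \bigcap_n [set` N n] = [set 1%g]].

Definition box_metric (R : realType) (S : set G) (N : nat -> normalClosed G)
    (n : nat) : quotient_group (N n) -> quotient_group (N n) -> R :=
  word_metric R (quotient_proj (N n) @` S).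

End box_space.

Arguments box_metric {G} R S N n.

(* Real Hilbert spaces; idfun is the (trivial) conjugation, so that
   {dot V for idfun} is the type of symmetric positive definite bilinear
   forms. *)
HB.mixin Record CompleteNormedModule_isHilbert (R : realType) (V : Type)
    & CompleteNormedModule R V := {
  inner : {dot V for idfun} ;
  sqr_norm_inner : forall x : V, `|x| ^+ 2 = inner x x
}.

#[short(type="hilbertType")]
HB.structure Definition Hilbert (R : realType) :=
  {V of CompleteNormedModule R V & CompleteNormedModule_isHilbert R V}.

Section coarse_embedding.
Context {R : realType}.

(* f represents a function from [0, +oo[ to [0, +oo[, its values at negative
   arguments being irrelevant; proper means that preimages of bounded sets are
   bounded, and f need not be continuous or monotone. *)
Definition proper_function (f : R -> R) : Prop :=
  (forall t, 0 <= t -> 0 <= f t) /\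
  (forall A : set R, bounded_set A ->
     bounded_set [set t | 0 <= t /\ A (f t)]).

Definition coarse_embedding (I : Type) (X : I -> Type)
    (d : forall i, X i -> X i -> R) (Y : Type) (dY : Y -> Y -> R)
    (phi : forall i, X i -> Y) : Prop :=
  exists rho gamma : R -> R,
    [/\ proper_function rho, proper_function gamma &
        forall i (x y : X i),
          rho (d i x y) <= dY (phi i x) (phi i y) <= gamma (d i x y)].

Definition norm_dist (V : normedModType R) (u v : V) : R := `|u - v|.

Definition coarsely_embeds_in_Hilbert (I : Type) (X : I -> Type)
    (d : forall i, X i -> X i -> R) : Prop :=
  exists (H : hilbertType R) (phi : forall i, X i -> H),
    coarse_embedding d (@norm_dist H) phi.

End coarse_embedding.

Section representations.
Context {R : realType} {G : groupType} {H : hilbertType R}.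
Implicit Type pi : G -> {linear H -> H}.

Definition is_representation pi : Prop :=
  pi 1%g =1 id /\ forall g h, pi (g * h)%g =1 pi g \o pi h.

Definition norm_preserving pi : Prop := forall g v, `|pi g v| = `|v|.

Definition orthogonal_representation pi : Prop :=
  is_representation pi /\
  forall g u v, inner (pi g u) (pi g v) = inner u v.

Definition is_cocycle pi (b : G -> H) : Prop :=
  forall g h, b (g * h)%g = pi g (b h) + b g.

End representations.

(* For a finitely generated group G. Word metrics of two finite generating sets
   are bi-Lipschitz equivalent, so any finite generating set can serve as T. A
   single map is a family indexed by unit. The affine action of g is
   v |-> pi g v + b g. *)
Definition haagerup (R : realType) (G : groupType) : Prop :=
  exists T : set G, [/\ finite_set T, generates T &
    exists (H : hilbertType R) (pi : G -> {linear H -> H}) (b : G -> H),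
      [/\ is_representation pi, norm_preserving pi, is_cocycle pi b &
          coarse_embedding (fun _ : unit => word_metric R T)
            (@norm_dist R H) (fun _ : unit => b)]].

Definition relative_property_T (R : realType) (G : groupType) (Y : set G)
    : Prop :=
  forall (H : hilbertType R) (pi : G -> {linear H -> H}),
    orthogonal_representation pi ->
  forall v : nat -> H,
    (forall n, `|v n| = 1) ->
    (forall g, `|pi g (v n) - v n| @[n --> \oo] --> (0 : R)) ->
    sup [set `|pi y (v n) - v n| | y in Y] @[n --> \oo] --> (0 : R).

(* Main.v *)
Require Import Defs.
From HB Require Import structures.
From mathcomp Require Import all_boot all_order all_algebra.
From mathcomp Require Import sesquilinear.
From mathcomp Require Import boolp classical_sets functions cardinality.
From mathcomp Require Import reals topology normedtype sequences exp.
From mathcomp Require Import lra.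
From mathcomp.multinomials Require Import freeg.

Set Implicit Arguments.
Unset Strict Implicit.
Unset Printing Implicit Defensive.

Import Order.TTheory GRing.Theory Num.Theory.
Import numFieldNormedType.Exports.

Local Open Scope classical_set_scope.
Local Open Scope ring_scope.

(** A coarse embedding of the box space forces the Haagerup property, and the
Haagerup property is incompatible with relative Property T for an infinite
subset; both halves of the theorem follow.

From box space to Haagerup ([haagerup_box]).  Let [phi n] be the embeddings of
the finite quotients [Q n] into [H0].  On the Hilbert space of functions from
[Q n] to [H0], with the inner product averaged over [Q n], the group acts by
right translation, and [c g x = phi n (x g) - phi n x] is a cocycle.  The
distance from [x] to [x g] in [Q n] does not depend on [x]: it is the length of
the image of [g].  So the squared norm of [c g] at level [n], being an average
of squared distances, lies between the squares of [rho] and [gamma] at that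
length, and the latter is the length of [g] in the group itself once [N n]
avoids a large enough ball ([word_length_box]).  Passing to the limit along an
ultrafilter ([cocycle_ultralimit]) gives an orthogonal representation with a
cocycle which is a coarse embedding with the same control functions.

From Haagerup to the failure of relative Property T
([haagerup_not_relative_T]).  By Schoenberg's theorem ([schoenberg]) the kernels
[exp (- |b g - b h|^2 / (k + 1)^2)] are positive definite, and they are
invariant under left translation.  The corresponding representations
([invariant_kernel_representation]), put together in one Hilbert space, carry
unit vectors [u k] with
[|pi g (u k) - u k|^2 = 2 - 2 exp (- |b g - b 1|^2 / (k + 1)^2)].  For fixed [g]
this tends to 0; but an infinite set leaves every ball, [b] is proper, and so
for every [k] some element of the set moves [u k] by at least 1.

Both constructions produce a vector space with a positive semidefinite form and
a group of isometries.  The completion of such a space is realized inside the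
algebraic dual: a point is a linear functional [w |-> lim B (u n) w] given by a
Cauchy sequence [u].  Vectors of length zero are then identified without
forming a quotient, the vector space structure is that of functions, and an
isometry acts by composition with its inverse. *)

(** * Positive semidefinite forms *)

Record psd_form (R : realType) (V : lmodType R) := PsdForm {
  psd_fun :> V -> V -> R;
  psdC : forall u v, psd_fun u v = psd_fun v u;
  psdP : forall a u v w, psd_fun (a *: u + v) w = a * psd_fun u w + psd_fun v w;
  psd_ge0 : forall u, 0 <= psd_fun u u
}.

Section psd_form_theory.
Context (R : realType) (V : lmodType R) (B : psd_form V).
Implicit Types (u v w : V) (a : R).

Lemma psdDl u v w : B (u + v) w = B u w + B v w.
Proof. by rewrite -[u]scale1r psdP mul1r scale1r. Qed.

Lemma psd0l w : B 0 w = 0.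
Proof. by apply: (addrI (B 0 w)); rewrite -psdDl !addr0. Qed.

Lemma psdZl a u w : B (a *: u) w = a * B u w.
Proof. by rewrite -[a *: u]addr0 psdP psd0l addr0. Qed.

Lemma psdNl u w : B (- u) w = - B u w.
Proof. by rewrite -scaleN1r psdZl mulN1r. Qed.

Lemma psdBl u v w : B (u - v) w = B u w - B v w.
Proof. by rewrite psdDl psdNl. Qed.

Lemma psdDr u v w : B w (u + v) = B w u + B w v.
Proof. by rewrite psdC psdDl !(psdC _ w). Qed.

Lemma psdZr a u w : B w (a *: u) = a * B w u.
Proof. by rewrite psdC psdZl (psdC _ w). Qed.

Lemma psdBr u v w : B w (u - v) = B w u - B w v.
Proof. by rewrite psdC psdBl !(psdC _ w). Qed.

Lemma psd_sumr I (r : seq I) (F : I -> V) w :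
  B w (\sum_(i <- r) F i) = \sum_(i <- r) B w (F i).
Proof.
elim: r => [|i r IH]; first by rewrite !big_nil psdC psd0l.
by rewrite !big_cons psdDr IH.
Qed.

(** The form is not assumed definite, so the usual division by [B v v] is only
available when one of the two squares is positive; when both vanish, the
square of [u - B u v *: v] is [- 2 (B u v)^2]. *)
Lemma psd_CauchySchwarz u v : B u v ^+ 2 <= B u u * B v v.
Proof.
have key x y : 0 <= B y y * (B y y * B x x - B x y ^+ 2).
  have := psd_ge0 B (B y y *: x - B x y *: y).
  by rewrite !(psdBl, psdBr, psdZl, psdZr) (psdC B y x); lra.
have [vv0|vv0] := ltP 0 (B v v).
  by have := key u v; rewrite pmulr_rge0// subr_ge0 mulrC.
have [uu0|uu0] := ltP 0 (B u u).
  by have := key v u; rewrite pmulr_rge0// subr_ge0 (psdC B v u).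
have vv : B v v = 0 by apply/eqP; rewrite eq_le vv0 psd_ge0.
have uu : B u u = 0 by apply/eqP; rewrite eq_le uu0 psd_ge0.
have := psd_ge0 B (u - B u v *: v).
by rewrite !(psdBl, psdBr, psdZl, psdZr) (psdC B v u) uu vv; lra.
Qed.

Lemma psdD_le u v : B (u + v) (u + v) <= 2 * B u u + 2 * B v v.
Proof.
have := psd_ge0 B (u - v).
by rewrite !(psdBl, psdBr, psdDl, psdDr) (psdC B v u); lra.
Qed.

End psd_form_theory.

Section representing_sequences.
Context (R : realType) (V : lmodType R) (B : psd_form V).
Implicit Types (u v : nat -> V) (w : V) (f g h : V -> R).

Definition psd_cauchy u := forall e, 0 < e -> exists N, forall m n,
  (N <= m)%N -> (N <= n)%N -> B (u m - u n) (u m - u n) <= e.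

(** The functional [f] is the point of the completion to which the Cauchy
sequence [u] converges. *)
Definition represents u f :=
  psd_cauchy u /\ forall w, B (u n) w @[n --> \oo] --> f w.

(** Cauchy-Schwarz for [u m - u n], with [m] going to infinity: a representing
sequence converges to its functional uniformly on bounded sets. The
other estimates on representing sequences come from this one. *)
Lemma represents_tail u f e : represents u f -> 0 < e ->
  exists N, forall n, (N <= n)%N ->
    forall w, (f w - B (u n) w) ^+ 2 <= e * B w w.
Proof.
move=> [cu uf] e0; have [N uN] := cu _ e0; exists N => n Nn w.
have cl : (B (u m) w - B (u n) w) ^+ 2 @[m --> \oo] --> (f w - B (u n) w) ^+ 2.
  rewrite expr2; under eq_fun do rewrite expr2.
  by apply: cvgM; apply: cvgB => //; exact: cvg_cst.
apply: (cvgr_to_le cl); near=> m.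
rewrite -psdBl (le_trans (psd_CauchySchwarz _ _ _))//.
rewrite ler_wpM2r ?psd_ge0// uN//.
by near: m; exact: nbhs_infty_ge.
Unshelve. all: by end_near. Qed.

Lemma represents_lin u f a w1 w2 : represents u f ->
  f (a *: w1 + w2) = a * f w1 + f w2.
Proof.
move=> [_ uf].
suff lim2 : B (u n) (a *: w1 + w2) @[n --> \oo] --> a * f w1 + f w2.
  exact: (cvg_unique _ (uf _) lim2).
under eq_fun do rewrite psdDr psdZr.
by apply: cvgD => //; apply: cvgM => //; exact: cvg_cst.
Qed.

Lemma representsB u f w1 w2 : represents u f -> f (w1 - w2) = f w1 - f w2.
Proof.
move=> uf; have := represents_lin (- 1) w2 w1 uf.
by rewrite scaleN1r mulN1r addrC => ->; rewrite addrC.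
Qed.

Lemma represents_bounded u f : represents u f ->
  exists2 C, 0 < C & forall w, f w ^+ 2 <= C * B w w.
Proof.
move=> uf; have [N uN] := represents_tail uf ltr01.
exists (2 + 2 * B (u N) (u N)).
  by rewrite ltr_pwDl// mulr_ge0// psd_ge0.
move=> w; have uNw := uN _ (leqnn N) w.
have := psd_CauchySchwarz B (u N) w.
by have := sqr_ge0 (f w - B (u N) w - B (u N) w); lra.
Qed.

Lemma psd_cauchy_bounded u : psd_cauchy u ->
  exists2 C, 0 < C & \forall n \near \oo, B (u n) (u n) <= C.
Proof.
move=> cu; have [N uN] := cu _ ltr01.
exists (2 + 2 * B (u N) (u N)).
  by rewrite ltr_pwDl// mulr_ge0// psd_ge0.
near=> n.
have uNn : B (u n - u N) (u n - u N) <= 1.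
  by apply: uN => //; near: n; exact: nbhs_infty_ge.
have := psdD_le B (u n - u N) (u N); rewrite subrK => /le_trans; apply.
by rewrite lerD2r -[leRHS]mulr1 ler_pM2l.
Unshelve. all: by end_near. Qed.

Lemma represents_cvg_cauchy u f v : represents u f -> psd_cauchy v ->
  cvg (f (v n) @[n --> \oo]).
Proof.
move=> uf cv; have [C C0 fC] := represents_bounded uf.
apply: cauchy_cvg; apply: cauchy_exP => e e0.
have e'0 : 0 < (e / 2) ^+ 2 / C by rewrite divr_gt0// exprn_gt0// divr_gt0.
have [N vN] := cv _ e'0.
exists (f (v N)); rewrite -ball_normE.
change (\forall n \near \oo, `|f (v N) - f (v n)| < e).
near=> n; rewrite -(representsB _ _ uf).
suff /le_lt_trans : `|f (v N - v n)| <= e / 2.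
  by apply; rewrite ltr_pdivrMr// ltr_pMr// ltr1n.
rewrite -ler_sqr ?nnegrE//; last by rewrite divr_ge0// ltW.
rewrite real_normK ?num_real// (le_trans (fC _))//.
have := vN N n (leqnn N); rewrite ler_pdivlMr// mulrC; apply.
by near: n; exact: nbhs_infty_ge.
Unshelve. all: by end_near. Qed.

(** The uniformity in [represents_tail] allows evaluating at a point that
moves with [n]. Hence [f (v n)] and [B (u n) (v n)] have the same limit, and,
the latter expression being symmetric, the pairing of two points can be
computed from either of them. *)
Lemma represents_diff u f v : represents u f -> psd_cauchy v ->
  f (v n) - B (u n) (v n) @[n --> \oo] --> (0 : R).
Proof.
move=> uf cv; have [C C0 vC] := psd_cauchy_bounded cv.
apply/cvgr0Pnorm_le => e e0.
have [N uN] := represents_tail uf (divr_gt0 (exprn_gt0 2 e0) C0).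
near=> n.
rewrite -ler_sqr ?nnegrE//; last exact: ltW.
rewrite real_normK ?num_real//.
have Nn : (N <= n)%N by near: n; exact: nbhs_infty_ge.
rewrite (le_trans (uN n Nn _))// -mulrA ger_pMr ?exprn_gt0//.
rewrite ler_pdivrMl// mulr1.
by near: n.
Unshelve. all: by end_near. Qed.

Lemma represents_lim u f v g (l : R) : represents u f -> represents v g ->
  f (v n) @[n --> \oo] --> l -> B (u n) (v n) @[n --> \oo] --> l.
Proof.
move=> uf [cv _] fl; have d := represents_diff uf cv.
have -> : (fun n => B (u n) (v n)) =
    fun n => f (v n) - (f (v n) - B (u n) (v n)).
  by apply/funext => n; rewrite subKr.
by rewrite -[l]subr0; exact: cvgB.
Qed.

Lemma represents_limr u f v g (l : R) : represents u f -> represents v g ->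
  B (u n) (v n) @[n --> \oo] --> l -> f (v n) @[n --> \oo] --> l.
Proof.
move=> uf [cv _] fl; have d := represents_diff uf cv.
have -> : (fun n => f (v n)) =
    fun n => B (u n) (v n) + (f (v n) - B (u n) (v n)).
  by apply/funext => n; rewrite subrKC.
by rewrite -[l]addr0; exact: cvgD.
Qed.

Lemma represents_swap u f v g (l : R) : represents u f -> represents v g ->
  f (v n) @[n --> \oo] --> l -> g (u n) @[n --> \oo] --> l.
Proof.
move=> uf vg /(represents_lim uf vg).
under eq_fun do rewrite psdC.
exact: (represents_limr vg uf).
Qed.

Lemma represents_uniq u f v g v' : represents u f -> represents v g ->
  represents v' g ->
  forall l l' : R, f (v n) @[n --> \oo] --> l -> f (v' n) @[n --> \oo] --> l' ->
  l = l'.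
Proof.
move=> uf vg v'g l l' /(represents_swap uf vg) gl /(represents_swap uf v'g) gl'.
exact: (cvg_unique _ gl gl').
Qed.

Lemma psd_cauchy_represents u : psd_cauchy u ->
  exists f, represents u f.
Proof.
move=> cu; exists (fun w => lim (B (u n) w @[n --> \oo])); split=> // w.
have -> : (fun n => B (u n) w) = fun n => B w (u n).
  by apply/funext => n; rewrite psdC.
apply: (@represents_cvg_cauchy (fun=> w) (B w)) => //; split.
  by move=> e e0; exists 0 => *; rewrite subrr psd0l ltW.
by move=> w'; exact: cvg_cst.
Qed.

End representing_sequences.

(** * The Hilbert space of a positive semidefinite form *)

Section completion_space.
Context (R : realType) (V : lmodType R) (B : psd_form V).

Definition completion_pred : {pred V -> R} :=
  fun f => `[< exists u, represents B u f >].

Fact completion_submod : GRing.submod_closed completion_pred.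
Proof.
split=> [|a f g /asboolP[u [cu uf]] /asboolP[v [cv vg]]]; apply/asboolP.
  exists (fun=> 0); split=> [e e0|w].
    by exists 0 => *; rewrite subrr psd0l ltW.
  by under eq_fun do rewrite psd0l; exact: cvg_cst.
exists (fun n => a *: u n + v n); split=> [e e0|w].
  have a0 : 0 < 2 * (a ^+ 2 + 1) by rewrite mulr_gt0// ltr_wpDl// sqr_ge0.
  have [N1 uN] := cu _ (divr_gt0 (divr_gt0 e0 (ltr0Sn _ 1)) a0).
  have [N2 vN] := cv _ (divr_gt0 e0 (ltr0Sn _ 3)).
  exists (maxn N1 N2) => m n; rewrite !geq_max => /andP[m1 m2] /andP[n1 n2].
  have -> : a *: u m + v m - (a *: u n + v n) =
      a *: (u m - u n) + (v m - v n).
    by rewrite scalerBr opprD addrACA.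
  rewrite (le_trans (psdD_le _ _ _))// psdZl psdZr.
  have := vN _ _ m2 n2; have := uN _ _ m1 n1; rewrite ler_pdivlMr//.
  have := psd_ge0 B (u m - u n); nra.
under eq_fun do rewrite psdP.
by apply: cvgD => //; apply: cvgM => //; exact: cvg_cst.
Qed.

HB.instance Definition _ :=
  GRing.isSubmodClosed.Build R (V -> R) completion_pred completion_submod.

Record completion := Completion {
  completion_val :> V -> R;
  completion_valP : completion_val \in completion_pred }.

HB.instance Definition _ := [isSub for completion_val].
HB.instance Definition _ := [Choice of completion by <:].
HB.instance Definition _ := [SubChoice_isSubLmodule of completion by <:].

Implicit Types (f g h : completion) (u v : nat -> V) (w : V).

Lemma approxP f : exists u, represents B u f.
Proof. exact/asboolP/(completion_valP f). Qed.

Definition approx f := sval (cid (approxP f)).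

Lemma approx_represents f : represents B (approx f) f.
Proof. by rewrite /approx; case: cid. Qed.

(** The limit of [B (u n) (v n)] for sequences [u], [v] representing [f], [g];
in this asymmetric form linearity in [f] is immediate. *)
Definition completion_inner f g : R := lim (f (approx g n) @[n --> \oo]).

Lemma completion_innerE v f g : represents B v g ->
  f (v n) @[n --> \oo] --> completion_inner f g.
Proof.
move=> vg; have uf := approx_represents f; have wg := approx_represents g.
have cw := represents_cvg_cauchy uf wg.1.
have cv := represents_cvg_cauchy uf vg.1.
rewrite /completion_inner (represents_uniq uf wg vg cw cv); exact: cv.
Qed.

Lemma completion_innerEr u f g : represents B u f ->
  g (u n) @[n --> \oo] --> completion_inner f g.
Proof.
move=> uf; have vg := approx_represents g.
exact: (represents_swap uf vg (completion_innerE vg)).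
Qed.

Lemma completion_innerC f g : completion_inner f g = completion_inner g f.
Proof.
have fg := @completion_innerE _ f _ (approx_represents g).
have gf := @completion_innerEr _ g f (approx_represents g).
exact: (cvg_unique _ fg gf).
Qed.

Lemma completion_addE f g w : (f + g) w = f w + g w.
Proof. by []. Qed.

Lemma completion_scaleE a f w : (a *: f) w = a * f w.
Proof. by []. Qed.

Lemma completion_innerP a f g h :
  completion_inner (a *: f + g) h =
  a * completion_inner f h + completion_inner g h.
Proof.
have hu := approx_represents h.
have l := @completion_innerE _ (a *: f + g) _ hu.
suff l' : (a *: f + g) (approx h n) @[n --> \oo] -->
    a * completion_inner f h + completion_inner g h.
  exact: (cvg_unique _ l l').
under eq_fun do rewrite completion_addE completion_scaleE.
apply: cvgD; last exact: completion_innerE.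
by apply: cvgM; [exact: cvg_cst|exact: completion_innerE].
Qed.

Lemma completion_inner_ge0 f : 0 <= completion_inner f f.
Proof.
have uf := approx_represents f.
have := represents_lim uf uf (completion_innerE uf).
by move=> /cvgr_to_ge; apply; near=> n; exact: psd_ge0.
Unshelve. all: by end_near. Qed.

Definition completion_form : psd_form completion :=
  PsdForm completion_innerC completion_innerP completion_inner_ge0.

Let innerE f g : completion_inner f g = completion_form f g.
Proof. by []. Qed.

(** By Cauchy-Schwarz, [(f w)^2] is at most the product of the square of [f]
and [B w w]; a point is a functional, so it vanishes as soon as its values do.
*)
Fact completion_inner_eq0 f : completion_inner f f = 0 -> f = 0.
Proof.
move=> ff0; apply/val_inj/funext => w /=.
have uf := approx_represents f.
have uu0 := represents_lim uf uf (completion_innerE uf).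
rewrite ff0 in uu0.
have fw2 : B (approx f n) w * B (approx f n) w @[n --> \oo] --> f w * f w.
  by apply: cvgM; exact: uf.2.
have : f w * f w <= 0 * B w w.
  apply: (ler_cvg_to fw2 (cvgM uu0 (cvg_cst (B w w)))).
  by near=> n; rewrite -expr2; exact: psd_CauchySchwarz.
rewrite mul0r -expr2 => fw0; apply/eqP.
by rewrite -sqrf_eq0 eq_le fw0 sqr_ge0.
Unshelve. all: by end_near. Qed.

Definition completion_norm f := Num.sqrt (completion_inner f f).

Fact completion_normD f g :
  completion_norm (f + g) <= completion_norm f + completion_norm g.
Proof.
rewrite -ler_sqr ?nnegrE ?addr_ge0 ?sqrtr_ge0//.
rewrite /completion_norm sqr_sqrtr ?completion_inner_ge0//.
rewrite sqrrD !sqr_sqrtr ?completion_inner_ge0//.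
have := psd_CauchySchwarz completion_form f g.
rewrite -[leLHS]real_normK ?num_real// -ler_sqrt; last first.
  by rewrite mulr_ge0 ?(psd_ge0 completion_form).
rewrite sqrtr_sqr normr_id sqrtrM ?completion_inner_ge0//= => cs.
have := le_trans (ler_norm _) cs.
have -> : completion_inner (f + g) (f + g) = completion_inner f f
    + 2 * completion_inner f g + completion_inner g g.
  by rewrite !innerE !(psdDl, psdDr) (psdC completion_form g f) /=; lra.
by rewrite -mulr_natl; lra.
Qed.

Fact completion_normZ a f : completion_norm (a *: f) = `|a| * completion_norm f.
Proof.
rewrite /completion_norm !innerE psdZl psdZr mulrA -expr2.
by rewrite sqrtrM ?sqr_ge0// sqrtr_sqr.
Qed.

Fact completion_norm_eq0 f : completion_norm f = 0 -> f = 0.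
Proof.
move/eqP; rewrite sqrtr_eq0 => ff0; apply: completion_inner_eq0.
by apply/eqP; rewrite eq_le ff0 completion_inner_ge0.
Qed.

HB.instance Definition _ := Lmodule_isNormed.Build R completion
  completion_normD completion_normZ completion_norm_eq0.

Lemma completion_normE f : `|f| = Num.sqrt (completion_inner f f).
Proof. by []. Qed.

Lemma sqr_completion_norm f : `|f| ^+ 2 = completion_inner f f.
Proof. by rewrite completion_normE sqr_sqrtr// completion_inner_ge0. Qed.

End completion_space.

Section completion_complete.
Context (R : realType) (V : lmodType R) (B : psd_form V).
Local Notation H := (completion B).
Implicit Types (f g h : H) (u v : nat -> V) (w : V).

Lemma embedding_subproof w : B w \in completion_pred B.
Proof.
apply/asboolP; exists (fun=> w); split=> [e e0|x]; last exact: cvg_cst.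
by exists 0 => *; rewrite subrr psd0l ltW.
Qed.

Definition embedding w : H := Completion (embedding_subproof w).

Lemma embedding_represents w : represents B (fun=> w) (embedding w).
Proof.
split=> [e e0|x]; last exact: cvg_cst.
by exists 0 => *; rewrite subrr psd0l ltW.
Qed.

Lemma embeddingP a w x :
  embedding (a *: w + x) = a *: embedding w + embedding x.
Proof. by apply/val_inj/funext => y; exact: psdP. Qed.

Lemma embeddingD w x : embedding (w + x) = embedding w + embedding x.
Proof. by rewrite -[w]scale1r embeddingP !scale1r. Qed.

Lemma embeddingB w x : embedding (w - x) = embedding w - embedding x.
Proof. by rewrite addrC -scaleN1r embeddingP scaleN1r addrC. Qed.

Lemma completion_inner_embedding f w : completion_inner f (embedding w) = f w.
Proof.
have l := completion_innerE (embedding_represents w) (f := f).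
exact: (cvg_unique _ l (cvg_cst (f w))).
Qed.

Lemma inner_embedding w x :
  completion_inner (embedding w) (embedding x) = B w x.
Proof. exact: completion_inner_embedding. Qed.

Lemma norm_embedding w : `|embedding w| = Num.sqrt (B w w).
Proof. by rewrite completion_normE inner_embedding. Qed.

(** The squared distance is [f f - 2 f (u n) + B (u n) (u n)], whose three
terms tend to the square of [f] up to their coefficients. *)
Lemma represents_cvg u f e : represents B u f -> 0 < e ->
  \forall n \near \oo, `|f - embedding (u n)| < e.
Proof.
move=> uf e0; pose C := completion_form B.
have fE n : C (f - embedding (u n)) (f - embedding (u n)) =
    C f f - f (u n) - (f (u n) - B (u n) (u n)).
  rewrite !(psdBl, psdBr) (psdC C (embedding (u n)) f) /=.
  by rewrite !completion_inner_embedding.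
have ff := completion_innerE uf (f := f).
have uu := represents_lim uf uf ff.
have : C (f - embedding (u n)) (f - embedding (u n)) @[n --> \oo] -->
    C f f - C f f - (C f f - C f f).
  under eq_fun do rewrite fE.
  by apply: cvgB; apply: cvgB => //; exact: cvg_cst.
rewrite subrr => /cvgr0Pnorm_lt/(_ _ (exprn_gt0 2 e0)).
apply: filterS => n; rewrite ger0_norm ?psd_ge0//.
have -> : C (f - embedding (u n)) (f - embedding (u n)) =
    `|f - embedding (u n)| ^+ 2 by rewrite sqr_completion_norm.
by rewrite ltr_sqr ?nnegrE// ltW.
Qed.

(** A Cauchy filter is followed by vectors [v k] of the original space, which
is dense; they form a Cauchy sequence, and the point that it represents is the
limit of the filter. *)
Fact completion_cauchy_cvg (F : set_system H) : ProperFilter F ->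
  cauchy F -> cvg F.
Proof.
move=> FF /cauchyP Fc.
have dense f e : 0 < e -> exists w, `|f - embedding w| < e.
  move=> e0; have uf := approx_represents f.
  have [N _ uN] := represents_cvg uf e0.
  by exists (approx f N); exact: uN N (leqnn N).
have Fv k : exists w, F [set f | `|embedding w - f| < 2 / k.+1%:R].
  have k0 : 0 < (k.+1%:R : R)^-1 by rewrite invr_gt0.
  have [f Ff] := Fc _ k0; have [w fw] := dense f _ k0; exists w.
  apply: filterS Ff => g; rewrite -ball_normE /= => fg.
  rewrite -(subrKA f) (le_lt_trans (ler_normD _ _))// mulr_natl mulr2n.
  by apply: ltrD; [rewrite distrC; exact: fw|exact: fg].
have [v Fvk] := choice Fv.
have vdist k l :
    `|embedding (v k) - embedding (v l)| < 2 / k.+1%:R + 2 / l.+1%:R.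
  have [f [/= fk fl]] := filter_ex (filterI (Fvk k) (Fvk l)).
  rewrite -(subrKA f) (le_lt_trans (ler_normD _ _))// ltrD//.
  by rewrite distrC.
have small (e : R) : 0 < e -> exists N, forall n, (N <= n)%N -> 2 / n.+1%:R < e.
  move=> e0; exists (Num.bound (2 / e)) => n Nn.
  rewrite ltr_pdivrMr// mulrC -ltr_pdivrMr//.
  by rewrite (lt_trans (archi_boundP _)) ?ltr_nat// divr_ge0// ltW.
have cv : psd_cauchy B v.
  move=> e e0.
  have /small[N vN] : 0 < Num.sqrt e / 2 by rewrite divr_gt0// sqrtr_gt0.
  exists N => m n Nm Nn; rewrite -ler_sqrt -?norm_embedding ?ltW//.
  rewrite embeddingB (lt_trans (vdist _ _))//.
  by rewrite [ltRHS]splitr; apply: ltrD; exact: vN.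
have [f0 vf0] := psd_cauchy_represents cv.
have f0P : f0 \in completion_pred B by apply/asboolP; exists v.
pose f : H := Completion f0P.
apply: (@cvgP _ _ f); apply/cvg_ballP => e e0.
have e20 : 0 < e / 2 by rewrite divr_gt0.
have [N1 _ vN1] := represents_cvg (vf0 : represents B v f) e20.
have [N2 vN2] := small _ e20.
pose n := maxn N1 N2; apply: filterS (Fvk n) => g /= ng.
rewrite -ball_normE /= -(subrKA (embedding (v n))).
rewrite (le_lt_trans (ler_normD _ _))//.
rewrite [ltRHS]splitr; apply: ltrD; first exact: (vN1 n (leq_maxl _ _)).
exact: (lt_trans ng (vN2 n (leq_maxr _ _))).
Qed.

HB.instance Definition _ := Uniform_isComplete.Build H completion_cauchy_cvg.

Fact completion_inner_bilinear : bilinear_for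
  (GRing.Scale.Law.clone _ _ *%R _) (GRing.Scale.Law.clone _ _ (idfun \; *%R) _)
  (@completion_inner R V B).
Proof.
split=> [g a x y|g a x y] /=; first exact: completion_innerP.
rewrite completion_innerC completion_innerP.
by rewrite (completion_innerC x) (completion_innerC y).
Qed.

HB.instance Definition _ := bilinear_isBilinear.Build R H H R *%R (idfun \; *%R)
  (@completion_inner R V B) completion_inner_bilinear.

Fact completion_inner_hermitian f g :
  completion_inner f g = (-1) ^+ false * idfun (completion_inner g f).
Proof. by rewrite mul1r completion_innerC. Qed.

HB.instance Definition _ := isHermitianSesquilinear.Build R H false idfun
  (@completion_inner R V B) completion_inner_hermitian.

Fact completion_inner_gt0 f : f != 0 -> 0 < completion_inner f f.
Proof.
move=> f0; rewrite lt_def completion_inner_ge0 andbT.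
by apply: contra f0 => /eqP ff0; apply/eqP/completion_inner_eq0.
Qed.

HB.instance Definition _ := isDotProduct.Build R H
  (@completion_inner R V B) completion_inner_gt0.

HB.instance Definition _ := CompleteNormedModule_isHilbert.Build R H
  (@sqr_completion_norm R V B).

Lemma inner_completionE (f g : H) : inner f g = completion_inner f g.
Proof. by []. Qed.

End completion_complete.

(** * Isometric actions on completions *)

Record linear_action (R : realType) (G : groupType) (V : lmodType R) :=
  LinearAction {
    act :> G -> V -> V;
    actP : forall g a u v, act g (a *: u + v) = a *: act g u + act g v;
    act1 : forall u, act 1%g u = u;
    actM : forall g h u, act (g * h)%g u = act g (act h u)
  }.

Definition isometric (R : realType) (G : groupType) (V : lmodType R)
    (T : linear_action G V) (B : psd_form V) :=
  forall g u v, B (T g u) (T g v) = B u v.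

Section completion_rep.
Context (R : realType) (G : groupType) (V : lmodType R).
Context (T : linear_action G V) (B : psd_form V) (isoT : isometric T B).
Local Notation H := (completion B).
Implicit Types (f : H) (g h : G) (u : nat -> V) (w : V).

Lemma actB g (u v : V) : T g (u - v) = T g u - T g v.
Proof. by rewrite addrC -scaleN1r actP scaleN1r addrC. Qed.

Lemma actK g w : T g (T g^-1%g w) = w.
Proof. by rewrite -actM mulgV act1. Qed.

Fact act_represents g u (f : V -> R) : represents B u f ->
  represents B (fun n => T g (u n)) (fun w => f (T g^-1%g w)).
Proof.
move=> [cu uf]; split=> [e e0|w].
  have [N uN] := cu _ e0; exists N => m n Nm Nn.
  by rewrite -actB isoT uN.
have -> : (fun n => B (T g (u n)) w) = fun n => B (u n) (T g^-1%g w).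
  by apply/funext => n; rewrite -[in LHS](actK g w) isoT.
exact: uf.
Qed.

Fact completion_act_subproof g f :
  (fun w => f (T g^-1%g w)) \in completion_pred B.
Proof.
apply/asboolP; exists (fun n => T g (approx f n)).
exact/act_represents/approx_represents.
Qed.

(** Translation by [g] of a functional is composition with [g^-1]; it extends
the action on the original space because the form is invariant. *)
Definition completion_act g f : H := Completion (completion_act_subproof g f).

Fact completion_act_linear g : linear (completion_act g).
Proof. by move=> a f1 f2; apply/val_inj/funext. Qed.

HB.instance Definition _ g :=
  GRing.isLinear.Build R H H *:%R (completion_act g) (completion_act_linear g).

Definition completion_rep g : {linear H -> H} := completion_act g.

Lemma completion_rep_embedding g w :
  completion_rep g (embedding B w) = embedding B (T g w).
Proof.
by apply/val_inj/funext => x /=; rewrite -[in RHS](actK g x) isoT.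
Qed.

Lemma completion_rep_orthogonal : orthogonal_representation completion_rep.
Proof.
split; first split.
- by move=> f; apply/val_inj/funext => w /=; rewrite invg1 act1.
- by move=> g h f; apply/val_inj/funext => w /=; rewrite invgM actM.
move=> g f1 f2; have uf := approx_represents f2.
have l1 := completion_innerE uf (f := f1).
have l2 : completion_rep g f1 (T g (approx f2 n)) @[n --> \oo] -->
    completion_inner (completion_rep g f1) (completion_rep g f2).
  exact/completion_innerE/act_represents.
have E : (fun n => completion_rep g f1 (T g (approx f2 n))) =
    fun n => f1 (approx f2 n).
  by apply/funext => n; rewrite /= -actM mulVg act1.
by rewrite E in l2; rewrite !inner_completionE; exact: (cvg_unique _ l2 l1).
Qed.

Lemma orthogonal_norm_preserving (K : hilbertType R)
    (pi : G -> {linear K -> K}) :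
  orthogonal_representation pi -> norm_preserving pi.
Proof.
move=> [_ iso] g v; apply/eqP.
by rewrite -(@eqrXn2 _ 2)// !sqr_norm_inner iso.
Qed.

End completion_rep.

(** * Limits of forms along an ultrafilter *)

Section ultralimit.
Context (R : realType) (U : set_system nat) (UU : UltraFilter U).

Lemma ultra_fmap (T : Type) (x : nat -> T) : UltraFilter (x @ U).
Proof.
split=> [|F FF UF]; first exact: fmap_proper_filter.
rewrite predeqE => A; split=> [FA|]; last exact: UF.
have [//|UnA] := in_ultra_setVsetC (x @^-1` A) UU.
have FnA : F (~` A) by exact: UF.
by have [? []] := filter_ex (filterI FA FnA).
Qed.

(** This is where the ultrafilter enters: bounded sequences converge along it,
with no choice of a subsequence, so that the limit of the forms is defined on
all bounded families at once and is still bilinear and invariant. *)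
Lemma ultra_cvg (x : nat -> R) (M : R) : (forall n, `|x n| <= M) ->
  cvg (x n @[n --> U]).
Proof.
move=> xM; have := @segment_compact R (- M) M; rewrite compact_ultra => cM.
have UM : (x @ U) `[- M, M]%classic.
  change (\forall n \near U, x n \in `[- M, M]).
  by near=> n; rewrite in_itv/= -ler_norml.
have [l [_ xl]] := cM _ (ultra_fmap x) UM.
exact: cvgP xl.
Unshelve. all: by end_near. Qed.

Context (E : lmodType R) (B : nat -> psd_form E).

Definition bounded_pred : {pred E} :=
  fun c => `[< exists M, forall n, B n c c <= M >].

Fact bounded_submod : GRing.submod_closed bounded_pred.
Proof.
split=> [|a c d /asboolP[M cM] /asboolP[M' dM]]; apply/asboolP.
  by exists 0 => n; rewrite psd0l.
exists (2 * (a ^+ 2 * M) + 2 * M') => n.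
rewrite (le_trans (psdD_le _ _ _))// psdZl psdZr.
by rewrite lerD// ler_wpM2l// mulrA -expr2 ler_wpM2l ?sqr_ge0.
Qed.

HB.instance Definition _ :=
  GRing.isSubmodClosed.Build R E bounded_pred bounded_submod.

Record bounded_family := BoundedFamily {
  family_val :> E;
  family_valP : family_val \in bounded_pred }.

HB.instance Definition _ := [isSub for family_val].
HB.instance Definition _ := [Choice of bounded_family by <:].
HB.instance Definition _ := [SubChoice_isSubLmodule of bounded_family by <:].

Implicit Types (c d e : bounded_family).

Lemma family_bounded c : exists M, forall n, B n c c <= M.
Proof. exact/asboolP/(family_valP c). Qed.

Definition ultraform c d : R := lim (B n c d @[n --> U]).

Lemma ultraform_cvg c d : B n c d @[n --> U] --> ultraform c d.
Proof.
have [M cM] := family_bounded c; have [M' dM] := family_bounded d.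
apply: (@ultra_cvg _ (M + M')) => n.
have := psd_ge0 (B n) (val c - val d); have := psd_ge0 (B n) (val c + val d).
rewrite !(psdBl, psdBr, psdDl, psdDr) (psdC (B n) d c) ler_norml.
have := cM n; have := dM n.
have := psd_ge0 (B n) c; have := psd_ge0 (B n) d.
by move=> *; apply/andP; split; lra.
Qed.

Fact ultraformC c d : ultraform c d = ultraform d c.
Proof.
by rewrite /ultraform; congr (lim (_ @ U)); apply/funext => n; rewrite psdC.
Qed.

Fact ultraformP a c d e :
  ultraform (a *: c + d) e = a * ultraform c e + ultraform d e.
Proof.
have l := @ultraform_cvg (a *: c + d) e.
suff l' : B n (val (a *: c + d)) e @[n --> U] -->
    a * ultraform c e + ultraform d e by exact: (cvg_unique _ l l').
have -> : (fun n => B n (val (a *: c + d)) e) =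
    (fun n => a * B n c e + B n d e) by apply/funext => n; rewrite -psdP.
by apply: cvgD; [apply: cvgM; [exact: cvg_cst|]|]; exact: ultraform_cvg.
Qed.

Lemma ultraform_le c d M : (\forall n \near U, B n c d <= M) ->
  ultraform c d <= M.
Proof. exact/cvgr_to_le/ultraform_cvg. Qed.

Lemma ultraform_ge c d M : (\forall n \near U, M <= B n c d) ->
  M <= ultraform c d.
Proof. exact/cvgr_to_ge/ultraform_cvg. Qed.

Fact ultraform_ge0 c : 0 <= ultraform c c.
Proof. by apply: ultraform_ge; apply: filterE => n; exact: psd_ge0. Qed.

Definition ultralimit_form : psd_form bounded_family :=
  PsdForm ultraformC ultraformP ultraform_ge0.

Context (G : groupType) (T : linear_action G E).
Context (isoT : forall n, isometric T (B n)).

Fact bounded_act_subproof g c : T g c \in bounded_pred.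
Proof.
have [M cM] := family_bounded c; apply/asboolP; exists M => n.
by rewrite isoT.
Qed.

Definition bounded_act_fun g c := BoundedFamily (bounded_act_subproof g c).

Fact bounded_actP g a c d : bounded_act_fun g (a *: c + d) =
  a *: bounded_act_fun g c + bounded_act_fun g d.
Proof. by apply: val_inj; rewrite /= actP. Qed.

Fact bounded_act1 c : bounded_act_fun 1%g c = c.
Proof. by apply: val_inj; rewrite /= act1. Qed.

Fact bounded_actM g h c :
  bounded_act_fun (g * h)%g c = bounded_act_fun g (bounded_act_fun h c).
Proof. by apply: val_inj; rewrite /= actM. Qed.

Definition bounded_act := LinearAction bounded_actP bounded_act1 bounded_actM.

Lemma bounded_act_isometric : isometric bounded_act ultralimit_form.
Proof.
move=> g c d; rewrite /= /ultraform; congr (lim (_ @ U)).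
by apply/funext => n; rewrite isoT.
Qed.

End ultralimit.

(** The cocycle takes its values in families that are bounded for the forms [B
n], and its image in the completion for the limit form has as squared norm the
limit of [B n (c g) (c g)]. *)
Theorem cocycle_ultralimit (R : realType) (G : groupType) (E : lmodType R)
    (B : nat -> psd_form E) (T : linear_action G E) (c : G -> E)
    (m M : G -> R) :
  (forall n, isometric T (B n)) ->
  (forall g h, c (g * h)%g = T g (c h) + c g) ->
  (forall g, exists K, forall n, B n (c g) (c g) <= K) ->
  (forall g, \forall n \near \oo, m g ^+ 2 <= B n (c g) (c g) <= M g ^+ 2) ->
  (forall g, 0 <= m g) -> (forall g, 0 <= M g) ->
  exists (H : hilbertType R) (pi : G -> {linear H -> H}) (b : G -> H),
    [/\ orthogonal_representation pi, is_cocycle pi b &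
        forall g, m g <= `|b g| <= M g].
Proof.
move=> isoT cM cK cmM m0 M0.
have [U [UU oU]] := ultraFilterLemma (eventually_filter : ProperFilter \oo).
have cP g : c g \in bounded_pred B by exact/asboolP/cK.
pose d g := BoundedFamily (cP g).
pose iso := bounded_act_isometric UU isoT.
exists (completion (ultralimit_form UU B)).
exists (completion_rep iso), (fun g => embedding _ (d g)).
split; first exact: completion_rep_orthogonal.
- move=> g h; rewrite completion_rep_embedding -embeddingD; congr embedding.
  by apply: val_inj; rewrite /= cM.
move=> g; rewrite norm_embedding; apply/andP; split.
  rewrite -[leLHS]ger0_norm// -sqrtr_sqr ler_wsqrtr//.
  by apply: ultraform_ge; apply: oU; apply: filterS (cmM g) => n /andP[].
rewrite -[leRHS]ger0_norm// -sqrtr_sqr ler_wsqrtr//.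
by apply: ultraform_le; apply: oU; apply: filterS (cmM g) => n /andP[].
Qed.

(** * Word lengths in a group and in its finite quotients *)

Section word_length_theory.
Context (G : groupType) (S : set G).
Implicit Types (g h : G) (v w : seq G).
Local Open Scope group_scope.

Lemma words_cat g h v w :
  words S g v -> words S h w -> words S (g * h) (v ++ w).
Proof.
move=> [Sv <-] [Sw <-]; split; last by rewrite big_cat.
by move=> s; rewrite mem_cat => /orP[/Sv|/Sw].
Qed.

Lemma words_inv g w : words S g w -> words S g^-1 (rev [seq s^-1 | s <- w]).
Proof.
move=> [Sw <-]; split=> [s|].
  rewrite mem_rev => /mapP[t /Sw + ->]; rewrite invgK.
  by move=> [|]; [right|left].
elim: w {Sw} => [|s w IH]; first by rewrite !big_nil invg1.
by rewrite /= rev_cons -cats1 big_cat/= IH big_seq1 big_cons invgM.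
Qed.

Definition word_ball n := [set g | exists2 w, words S g w & (size w <= n)%N].

Lemma finite_word_ball n : finite_set S -> finite_set (word_ball n).
Proof.
move=> finS; elim: n => [|n IH].
  apply: (@sub_finite_set _ _ [set 1]); last exact: finite_set1.
  by move=> g [[|//] [_ <-] _] /=; rewrite big_nil.
have finS' : finite_set (S `|` [set s^-1 | s in S]).
  by rewrite finite_setU; split => //; exact: finite_image.
have := finite_image2 (fun s g => s * g) finS' IH.
move=> fin2; have finU : finite_set ([set 1] `|`
    [set s * g | s in S `|` [set s^-1 | s in S] & g in word_ball n]).
  by rewrite finite_setU; split.
apply: sub_finite_set finU => g [[|s w] [Sw <-] sw] /=.
  by left; rewrite big_nil.
right; rewrite big_cons; exists s.
  have [Ss|Ss] := Sw s (mem_head _ _); first by left.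
  by right; exists s^-1; rewrite ?invgK.
exists (\prod_(t <- w) t) => //; exists w => //; split=> // t tw.
by apply: Sw; rewrite inE tw orbT.
Qed.

(** The infimum is attained because it is taken over a set of natural numbers.
*)
Lemma word_length_spec (R : realType) g : words S g !=set0 -> exists w,
  [/\ words S g w, word_length R S g = (size w)%:R &
      forall v, words S g v -> (size w <= size v)%N].
Proof.
move=> [w0 Sw0].
have exn : exists n, `[< exists2 w, words S g w & size w = n >].
  by exists (size w0); apply/asboolP; exists w0.
have [_ /asboolP[w Sw <-] wmin] := ex_minnP exn; exists w.
have {}wmin v : words S g v -> (size w <= size v)%N.
  by move=> Sv; apply: wmin; apply/asboolP; exists v.
split=> //; apply/eqP; rewrite eq_le; apply/andP; split.
  apply: ge_inf; last by exists w.
  by exists 0%R => _ [v _ <-].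
apply: lb_le_inf; first by exists (size w)%:R, w.
by move=> _ [v Sv <-]; rewrite ler_nat wmin.
Qed.

Lemma word_length_ge0 (R : realType) g : (0 <= word_length R S g)%R.
Proof.
have [/(word_length_spec R)[w [_ -> _]]//|/set0P/negP/negPn/eqP nw] :=
  pselect (words S g !=set0).
by rewrite /word_length nw image_set0 inf0.
Qed.

End word_length_theory.

Section quotient_words.
Context (G : groupType) (S : set G) (N : normalClosed G).
Local Open Scope group_scope.
Local Notation proj := (quotient_proj N).

Lemma words_proj g w : words S g w -> words (proj @` S) (proj g) (map proj w).
Proof.
move=> [Sw <-]; split; last by rewrite big_map gmulf_prod.
move=> _ /mapP[s /Sw + ->]; rewrite -gmulfV.
by move=> [Ss|Ss]; [left; exists s|right; exists s^-1].
Qed.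

Lemma words_lift q w : words (proj @` S) q w ->
  exists g v, [/\ words S g v, proj g = q & size v = size w].
Proof.
move=> [Sw <-]; elim: w Sw => [|s w IH] Sw.
  by exists 1, [::]; split; rewrite ?big_nil ?gmulf1//; split; rewrite ?big_nil.
have [|g [v [Sv pg sv]]] := IH.
  by move=> t tw; apply: Sw; rewrite inE tw orbT.
have [t [tS ts]] : exists t, (S t \/ S t^-1) /\ proj t = s.
  have [[t St ts]|[t St ts]] := Sw s (mem_head _ _).
    by exists t; split; [left|].
  exists t^-1; split; first by right; rewrite invgK.
  by rewrite -[RHS]invgK -ts -gmulfV.
exists (t * g), (t :: v); split; last by rewrite /= sv.
  split; last by rewrite big_cons (proj2 Sv).
  by move=> x; rewrite inE => /orP[/eqP ->//|/(proj1 Sv)].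
by rewrite big_cons quotient_proj_gmulfM ts pg.
Qed.

Lemma word_length_proj_le (R : realType) g : generates S ->
  (word_length R (proj @` S) (proj g) <= word_length R S g)%R.
Proof.
move=> genS; have [w [Sw -> _]] := word_length_spec R (genS g).
have Spw := words_proj Sw.
have [|v [_ -> /(_ _ Spw)]] :=
    word_length_spec R (S := proj @` S) (g := proj g).
  by exists (map proj w).
by rewrite size_map ler_nat.
Qed.

End quotient_words.

Section box_length.
Context (R : realType) (G : groupType) (S : set G).
Hypotheses (finS : finite_set S) (genS : generates S).
Context (N : nat -> normalClosed G) (boxN : box_filtration N).
Local Open Scope group_scope.

Lemma box_nested m n : (m <= n)%N -> {subset N n <= N m}.
Proof.
have [_ sN _ _] := boxN.
move=> /subnK <-; elim: (n - m)%N => [//|k IH] x /sN; exact: IH.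
Qed.

(** Each of the finitely many nontrivial elements of [A] leaves some [N k],
and stays outside the smaller subgroups. *)
Lemma box_separates (A : set G) : finite_set A ->
  \forall n \near \oo, forall h, A h -> h \in N n -> h = 1.
Proof.
move=> /finite_seqP[s ->]; have [_ _ _ capN] := boxN.
have kP h : exists k, h \in N k -> h = 1.
  have [->|/eqP h1] := eqVneq h 1; first by exists 0.
  have : ~ (\bigcap_n [set` N n]) h by rewrite capN.
  move=> /existsNP[k /not_implyP[_ /= hk]]; exists k.
  by move=> /hk.
have [k {}kP] := choice kP.
exists (\max_(h <- s) k h) => // n /= kn h hs hn; apply: kP.
by apply: box_nested hn; apply: leq_trans kn; exact: leq_bigmax_seq.
Qed.

(** A shortest word for the image of [g] lifts to a word for some [h] in the
coset of [g]. Both have length at most that of [g], so [g^-1 h] is an element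
of [N n] in a fixed finite ball, and it is trivial when [n] is large. *)
Lemma word_length_box g : \forall n \near \oo,
  word_length R (quotient_proj (N n) @` S) (quotient_proj (N n) g) =
  word_length R S g.
Proof.
have [w [Sw wE wmin]] := word_length_spec R (genS g).
have finB := finite_word_ball (size w + size w) finS.
apply: filterS (box_separates finB) => n sepn.
apply/eqP; rewrite eq_le word_length_proj_le//=.
have pSw := words_proj (N n) Sw.
have [|v [pSv vE vmin]] := word_length_spec R
    (S := quotient_proj (N n) @` S) (g := quotient_proj (N n) g).
  by exists (map (quotient_proj (N n)) w).
have [h [v' [Sv' ph sv']]] := words_lift pSv.
have := vmin _ pSw; rewrite size_map -sv' => vw.
have gh : g^-1 * h = 1.
  apply: sepn; last exact/quotient_projP.
  exists (rev [seq s^-1 | s <- w] ++ v').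
    exact: words_cat (words_inv Sw) Sv'.
  by rewrite size_cat size_rev size_map leq_add2l.
have hg : h = g by rewrite -[h](mulVKg g) gh mulg1.
by rewrite wE vE ler_nat -sv' wmin// -hg.
Qed.

End box_length.

(** * A coarsely embeddable box space gives a proper cocycle *)

Section inner_form.
Context (R : realType) (H : hilbertType R).

Fact inner_sym (u v : H) : inner u v = inner v u.
Proof. by rewrite [LHS]hermitian_subproof mul1r. Qed.

Fact inner_linl a (u v w : H) :
  inner (a *: u + v) w = a * inner u w + inner v w.
Proof. by rewrite linearPl. Qed.

Fact inner_ge0 (u : H) : 0 <= inner u u.
Proof. by rewrite -sqr_norm_inner sqr_ge0. Qed.

Definition inner_form : psd_form H := PsdForm inner_sym inner_linl inner_ge0.

Lemma sqr_normB (u v : H) :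
  `|u - v| ^+ 2 = inner u u + inner v v - 2 * inner u v.
Proof.
rewrite sqr_norm_inner -[LHS]/(inner_form (u - v) (u - v)).
by rewrite !(psdBl, psdBr) (psdC inner_form v u) /=; lra.
Qed.

End inner_form.

Section average_form.
Context (R : realType) (H : hilbertType R).
Context (X I : Type) (s : seq X) (k : X -> I).
Implicit Types (c d e : I -> H).

Definition average (f : X -> R) : R := (size s)%:R^-1 * \sum_(x <- s) f x.

(** The functions live on a type [I] that contains a copy of [X] along [k], so
that averages over different finite sets are forms on one and the same space.
*)
Definition average_inner c d : R :=
  average (fun x => inner (c (k x)) (d (k x))).

Fact average_innerC c d : average_inner c d = average_inner d c.
Proof. by congr (_ * _); apply: eq_bigr => x _; exact: inner_sym. Qed.

Fact average_innerP a c d e : average_inner (a *: c + d) e =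
  a * average_inner c e + average_inner d e.
Proof.
rewrite /average_inner /average mulrCA -mulrDr; congr (_ * _).
by rewrite mulr_sumr -big_split; apply: eq_bigr => x _; exact: inner_linl.
Qed.

Fact average_inner_ge0 c : 0 <= average_inner c c.
Proof.
apply: mulr_ge0; first by rewrite invr_ge0.
by apply: sumr_ge0 => x _; exact: inner_ge0.
Qed.

Definition average_form : psd_form (I -> H) :=
  PsdForm average_innerC average_innerP average_inner_ge0.

Lemma average_bounds (f : X -> R) m M : (0 < size s)%N ->
  (forall x, m <= f x <= M) -> m <= average f <= M.
Proof.
move=> s0 fmM; have s0' : 0 < (size s)%:R :> R by rewrite ltr0n.
have sumc K : \sum_(x <- s) K = (size s)%:R * K :> R.
  by rewrite big_const_seq count_predT iter_addr addr0 mulr_natl.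
rewrite /average ler_pdivlMl// ler_pdivrMl// -!sumc.
by apply/andP; split; apply: ler_sum => x _; have /andP[] := fmM x.
Qed.

End average_form.

Lemma finite_setT_enum (T : choiceType) : finite_set [set: T] ->
  exists s : seq T, uniq s /\ forall x, x \in s.
Proof.
move=> /finite_seqP[s sE]; exists (undup s); split; first exact: undup_uniq.
by move=> x; rewrite mem_undup; have : [set: T] x by []; rewrite sE.
Qed.

(** The sequences of functions from the quotients to [H0] are encoded as
functions on the disjoint union [I] of all the quotients, and [B n] averages
over the part indexed by [n]. *)
Theorem haagerup_box (R : realType) (G : groupType) (S : set G)
    (N : nat -> normalClosed G) :
  finite_set S -> generates S -> box_filtration N ->
  coarsely_embeds_in_Hilbert (box_metric R S N) -> haagerup R G.
Proof.
move=> finS genS boxN [H0 [phi [rho [gamma [rhoP gammaP phiP]]]]].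
exists S; split=> //.
pose Q n := quotient_group (N n).
have finQ n : finite_set [set: Q n] by have [_ _ + _] := boxN; exact.
pose s n : seq (Q n) := sval (cid (finite_setT_enum (finQ n))).
have [s_uniq s_mem] : (forall n, uniq (s n)) /\ (forall n x, x \in s n).
  by split=> n; rewrite /s; case: cid => ? [].
have s_gt0 n : (0 < size (s n))%N by have := s_mem n 1%g; case: (s n).
pose I := {n : nat & Q n}.
pose p n (g : G) : Q n := quotient_proj (N n) g.
pose shift g (i : I) : I := Tagged Q (tagged i * p (tag i) g)%g.
have shift1 i : shift 1%g i = i.
  by case: i => n x; rewrite /shift /p gmulf1 mulg1.
have shiftM g h i : shift h (shift g i) = shift (g * h)%g i.
  by rewrite /shift /p /= gmulfM mulgA.
pose act_fun g (c : I -> H0) : I -> H0 := fun i => c (shift g i).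
have act_funP g a c d : act_fun g (a *: c + d) = a *: act_fun g c + act_fun g d.
  by [].
have act_fun1 c : act_fun 1%g c = c.
  by apply/funext => i; rewrite /act_fun shift1.
have act_funM g h c : act_fun (g * h)%g c = act_fun g (act_fun h c).
  by apply/funext => i; rewrite /act_fun shiftM.
pose T := LinearAction act_funP act_fun1 act_funM.
pose B n := average_form H0 (s n) (fun x : Q n => Tagged Q x : I).
have isoT n : isometric T (B n).
  move=> g c d; congr (_ * _).
  (* Right translation by [p n g] permutes the quotient. *)
  rewrite -(big_map (fun x : Q n => x * p n g)%g xpredT
    (fun x => inner (c (Tagged Q x)) (d (Tagged Q x)))).
  apply: perm_big; apply: uniq_perm => //.
    by rewrite map_inj_uniq//; exact: mulIg.
  move=> x; rewrite s_mem; apply/mapP; exists (x * (p n g)^-1)%g => //.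
  by rewrite mulgVK.
pose c g : I -> H0 := fun i => phi _ (tagged (shift g i)) - phi _ (tagged i).
have cM g h : c (g * h)%g = T g (c h) + c g.
  apply/funext => -[n x].
  rewrite -[RHS]/(_ - phi n (x * p n g)%g + (phi n (x * p n g)%g - _)) subrKA.
  by rewrite /c /= /p gmulfM mulgA.
pose l n g : R := word_length R (p n @` S) (p n g).
have c_bounds g i : rho (l (tag i) g) <= `|c g i| <= gamma (l (tag i) g).
  case: i => n x; have := phiP n x (x * p n g)%g.
  by rewrite /norm_dist distrC /box_metric /word_metric mulKg.
have l0 n g : 0 <= l n g by exact: word_length_ge0.
have B_bounds n g : rho (l n g) ^+ 2 <= B n (c g) (c g) <= gamma (l n g) ^+ 2.
  apply: average_bounds => // x; rewrite -sqr_norm_inner.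
  have /andP[rc cg] := c_bounds g (Tagged Q x).
  rewrite !lerXn2r ?nnegrE//; first exact: (proj1 gammaP).
  exact: (proj1 rhoP).
have [||||H [pi [b [piP bM b_bounds]]]] := @cocycle_ultralimit R G _ B T c
    (fun g => rho (word_length R S g)) (fun g => gamma (word_length R S g))
    isoT cM.
(* The function [gamma] need not be bounded on bounded sets, but lengths
   are natural numbers, and those of the images of [g] are at most that of
   [g]. *)
- move=> g; have [w [Sw lw _]] := word_length_spec R (genS g).
  exists (\sum_(j < (size w).+1) gamma j%:R ^+ 2) => n.
  have /andP[_ /le_trans] := B_bounds n g; apply.
  have [|v [_ lv _]] := @word_length_spec _ (p n @` S) R (p n g).
    by exists (map (p n) w); exact: words_proj.
  have vw : (size v < (size w).+1)%N.
    by rewrite ltnS -(ler_nat R) -lv -lw; exact: word_length_proj_le.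
  rewrite /l lv (bigD1 (Ordinal vw))//= lerDl.
  by apply: sumr_ge0 => j _; exact: sqr_ge0.
- move=> g; apply: filterS (word_length_box R finS genS boxN g) => n <-.
  exact: B_bounds.
- by move=> g; apply: (proj1 rhoP); exact: word_length_ge0.
- by move=> g; apply: (proj1 gammaP); exact: word_length_ge0.
exists H, pi, b; have npi := orthogonal_norm_preserving piP.
split=> //; first exact: (proj1 piP).
exists rho, gamma; split=> // -[] x y.
rewrite /norm_dist /word_metric.
rewrite -[in b y](mulVKg x y) bM opprD addrCA subrr addr0 normrN npi.
exact: b_bounds.
Qed.

(** * Positive definite kernels *)

Lemma cvg_sum (R : realType) (I : Type) (s : seq I) (f : I -> nat -> R)
    (l : I -> R) : (forall i, f i n @[n --> \oo] --> l i) ->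
  \sum_(i <- s) f i n @[n --> \oo] --> \sum_(i <- s) l i.
Proof.
move=> fl; elim: s => [|i s IH].
  by under eq_fun do rewrite big_nil; rewrite big_nil; exact: cvg_cst.
by under eq_fun do rewrite big_cons; rewrite big_cons; exact: cvgD.
Qed.

Section kernels.
Context (R : realType) (X : choiceType).
Implicit Types (A K L : X -> X -> R) (s : seq X) (c : X -> R) (x y : X).

Definition quad s A c : R := \sum_(i <- s) \sum_(j <- s) c i * c j * A i j.

Definition psd_kernel K :=
  (forall x y, K x y = K y x) /\ forall s c, uniq s -> 0 <= quad s K c.

Lemma quad_cons x s A c : (forall y z, A y z = A z y) ->
  quad (x :: s) A c =
  c x ^+ 2 * A x x + 2 * c x * \sum_(j <- s) c j * A x j + quad s A c.
Proof.
move=> symA; rewrite /quad [LHS]big_cons big_cons.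
have -> : \sum_(i <- s) \sum_(j <- x :: s) c i * c j * A i j =
    \sum_(i <- s) c i * c x * A i x + quad s A c.
  by rewrite -big_split; apply: eq_bigr => i _; rewrite big_cons.
have -> : \sum_(j <- s) c x * c j * A x j = c x * \sum_(j <- s) c j * A x j.
  by rewrite mulr_sumr; apply: eq_bigr => j _; rewrite mulrA.
have -> : \sum_(j <- s) c j * c x * A j x = c x * \sum_(j <- s) c j * A x j.
  by rewrite mulr_sumr; apply: eq_bigr => j _; rewrite symA mulrCA mulrA.
by rewrite -/(quad s A c) expr2; lra.
Qed.

Lemma eq_quad s A A' c c' : (forall x, x \in s -> c x = c' x) ->
  (forall x y, x \in s -> y \in s -> A x y = A' x y) ->
  quad s A c = quad s A' c'.
Proof.
move=> cc' AA'; apply: eq_big_seq => i si; apply: eq_big_seq => j sj.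
by rewrite !cc'// AA'.
Qed.

Lemma quad_row0 x s A c : (forall y z, A y z = A z y) ->
  (forall y, y \in x :: s -> A x y = 0) -> quad (x :: s) A c = quad s A c.
Proof.
move=> symA A0; rewrite quad_cons// (A0 x (mem_head _ _)) mulr0 add0r.
rewrite big_seq big1 ?mulr0 ?add0r// => j js.
by rewrite (A0 j) ?mulr0// inE js orbT.
Qed.

(** Schur's product theorem, by elimination of one point [x] at a time. If [A
x x > 0], then [A] is the sum of the rank one kernel [A x y * A x z / A x x]
and of a kernel [A'] whose row at [x] vanishes and which is still positive
(complete the square in the coefficient of [x]); the product with [L] of the
first summand is [L] with rescaled coefficients, and the induction hypothesis
applies to the second one. If [A x x = 0], the row of [A] at [x] is already
zero. *)
Lemma quadM_ge0 s A L c : uniq s -> (forall x y, A x y = A y x) ->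
  psd_kernel L -> (forall d, 0 <= quad s A d) ->
  0 <= quad s (fun x y => A x y * L x y) c.
Proof.
move=> + + [symL L0]; elim: s A => [|x s IH] A.
  by move=> _ _ _; rewrite /quad big_nil.
move=> us symA A0; have /andP[xs us'] := us.
have symAL y z : A y z * L y z = A z y * L z y by rewrite symA symL.
have A0' d : 0 <= quad s A d.
  have := A0 (fun y => if y == x then 0 else d y).
  rewrite quad_cons// eqxx expr0n !(mulr0, mul0r) !add0r.
  rewrite (eq_quad (c' := d) (A' := A))// => y ys.
  by case: eqP => // yx; rewrite -yx ys in xs.
pose S d := \sum_(j <- s) d j * A x j.
have A0x d a : 0 <= a ^+ 2 * A x x + 2 * a * S d + quad s A d.
  have := A0 (fun y => if y == x then a else d y).
  rewrite quad_cons// eqxx (eq_quad (c' := d) (A' := A))//; last first.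
    by move=> y ys; case: eqP => // yx; rewrite -yx ys in xs.
  congr (0 <= _ + _ * _ + _); apply: eq_big_seq => y ys.
  by case: eqP => // yx; rewrite -yx ys in xs.
have Axx : 0 <= A x x.
  have := A0x (fun=> 0) 1; rewrite expr1n mul1r /S /quad.
  rewrite big1 ?mulr0 ?addr0; last by move=> j _; rewrite mul0r.
  by rewrite big1 ?addr0// => j _; rewrite big1// => k _; rewrite !mul0r.
have [Axx0|Axx0] := eqVneq (A x x) 0.
  have rowS d : S d = 0.
    apply/eqP/negPn/negP => S0.
    (* An affine function of the coefficient of [x] that stays nonnegative
       has slope [2 * S d = 0]: at this point it would take the value [-1].
       *)
    have := A0x d (- (quad s A d + 1) / (2 * S d)); rewrite Axx0 mulr0 add0r.
    rewrite [2 * _ * S d]mulrAC [2 * S d * _]mulrC.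
    rewrite divfK ?mulf_neq0 ?pnatr_eq0//.
    by rewrite opprD addrAC addNr add0r oppr_ge0 ler10.
  have row0 y : y \in x :: s -> A x y = 0.
    rewrite inE => /orP[/eqP -> //|ys].
    have := rowS (fun z => (z == y)%:R).
    rewrite /S (bigD1_seq y)//= eqxx mul1r big1 ?addr0// => z /negbTE ->.
    by rewrite mul0r.
  rewrite (@quad_row0 x s (fun y z => A y z * L y z))//; first exact: IH.
  by move=> y ys; rewrite row0// mul0r.
pose a := A x x; have a0 : 0 < a by rewrite lt_def Axx0.
pose A' y z := A y z - A x y * A x z / a.
have -> : quad (x :: s) (fun y z => A y z * L y z) c =
    a^-1 * quad (x :: s) L (fun y => c y * A x y) +
    quad (x :: s) (fun y z => A' y z * L y z) c.
  rewrite /quad mulr_sumr -big_split; apply: eq_bigr => i _ /=.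
  rewrite mulr_sumr -big_split; apply: eq_bigr => j _ /=.
  rewrite /A'; lra.
apply: addr_ge0.
  by apply: mulr_ge0; [rewrite invr_ge0 ltW|exact: L0].
have symA' y z : A' y z = A' z y by rewrite /A' symA [A x y * _]mulrC.
rewrite (@quad_row0 x s (fun y z => A' y z * L y z)); last 2 first.
- by move=> y z; rewrite symA' symL.
- by move=> y _; rewrite /A' mulrAC divff// mul1r subrr mul0r.
apply: IH => // d.
have -> : quad s A' d = quad s A d - S d ^+ 2 / a.
  rewrite /quad expr2 /S mulr_suml mulr_suml -sumrB.
  apply: eq_bigr => i _; rewrite mulr_sumr mulr_suml -sumrB.
  by apply: eq_bigr => j _; rewrite /A'; lra.
(* The minimizing coefficient of [x]. *)
have := A0x d (- S d / a); rewrite -/a.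
have -> : (- S d / a) ^+ 2 * a + 2 * (- S d / a) * S d + quad s A d =
   quad s A d - S d ^+ 2 / a.
  rewrite expr2 -mulrA divfK//; lra.
by [].
Qed.

Lemma psd_kernelM A L : psd_kernel A -> psd_kernel L ->
  psd_kernel (fun x y => A x y * L x y).
Proof.
move=> [symA A0] psdL; split=> [x y|s c us]; first by rewrite symA psdL.1.
by apply: quadM_ge0 => // d; exact: A0.
Qed.

Lemma psd_kernel_rank1 (f : X -> R) : psd_kernel (fun x y => f x * f y).
Proof.
split=> [x y|s c _]; first exact: mulrC.
have -> : quad s (fun x y => f x * f y) c = (\sum_(i <- s) c i * f i) ^+ 2.
  rewrite expr2 mulr_suml; apply: eq_bigr => i _.
  by rewrite mulr_sumr; apply: eq_bigr => j _; rewrite mulrACA.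
exact: sqr_ge0.
Qed.

Lemma psd_kernelX A n : psd_kernel A -> psd_kernel (fun x y => A x y ^+ n).
Proof.
move=> psdA; elim: n => [|n IH].
  have := psd_kernel_rank1 (fun=> 1).
  by under eq_fun do under eq_fun do rewrite mulr1.
under eq_fun do under eq_fun do rewrite exprS.
exact: psd_kernelM.
Qed.

Lemma psd_kernelD A L : psd_kernel A -> psd_kernel L ->
  psd_kernel (fun x y => A x y + L x y).
Proof.
move=> [symA A0] [symL L0]; split=> [x y|s c us]; first by rewrite symA symL.
have -> : quad s (fun x y => A x y + L x y) c = quad s A c + quad s L c.
  rewrite /quad -big_split; apply: eq_bigr => i _ /=.
  by rewrite -big_split; apply: eq_bigr => j _ /=; rewrite mulrDr.
by rewrite addr_ge0 ?A0 ?L0.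
Qed.

Lemma psd_kernelZ (a : R) A : 0 <= a -> psd_kernel A ->
  psd_kernel (fun x y => a * A x y).
Proof.
move=> a0 [symA A0]; split=> [x y|s c us]; first by rewrite symA.
have -> : quad s (fun x y => a * A x y) c = a * quad s A c.
  rewrite /quad mulr_sumr; apply: eq_bigr => i _ /=.
  by rewrite mulr_sumr; apply: eq_bigr => j _ /=; rewrite mulrCA.
by rewrite mulr_ge0 ?A0.
Qed.

Lemma psd_kernel_lim (K : nat -> X -> X -> R) L :
  (forall n, psd_kernel (K n)) ->
  (forall x y, K n x y @[n --> \oo] --> L x y) -> psd_kernel L.
Proof.
move=> psdK KL; split=> [x y|s c us].
  have E : (fun n => K n x y) = (fun n => K n y x).
    by apply/funext => n; rewrite (psdK n).1.
  have := KL x y; rewrite E => l; exact: (cvg_unique _ l (KL y x)).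
have l : quad s (K n) c @[n --> \oo] --> quad s L c.
  apply: (@cvg_sum _ _ s (fun i n => \sum_(j <- s) c i * c j * K n i j)) => i.
  apply: (@cvg_sum _ _ s (fun j n => c i * c j * K n i j)) => j.
  by apply: cvgM; [exact: cvg_cst|exact: KL].
by apply: (cvgr_to_ge l); apply: nearW => n; exact: (psdK n).2.
Qed.

Lemma psd_kernel_expR A : psd_kernel A -> psd_kernel (fun x y => expR (A x y)).
Proof.
move=> psdA; apply: (@psd_kernel_lim
  (fun n x y => series (exp_coeff (A x y)) n)); last first.
  by move=> x y; exact: is_cvg_series_exp_coeff.
elim=> [|n IH].
  have := psd_kernel_rank1 (fun=> 0).
  under eq_fun do under eq_fun do rewrite mulr0.
  by under [X in _ -> psd_kernel X]eq_fun do
    under eq_fun do rewrite /series /= big_geq//.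
under eq_fun do under eq_fun do rewrite /series /= big_nat_recr//=.
apply: psd_kernelD => //.
under eq_fun do under eq_fun do rewrite /exp_coeff /= mulrC.
by apply: psd_kernelZ; [rewrite invr_ge0|exact: psd_kernelX].
Qed.

Lemma psd_kernel_form (V : lmodType R) (B : psd_form V) (v : X -> V) :
  psd_kernel (fun x y => B (v x) (v y)).
Proof.
split=> [x y|s c _]; first exact: psdC.
have -> : quad s (fun x y => B (v x) (v y)) c =
    B (\sum_(i <- s) c i *: v i) (\sum_(i <- s) c i *: v i).
  rewrite psd_sumr; apply: eq_bigr => i _.
  rewrite psdC psd_sumr; apply: eq_bigr => j _.
  by rewrite psdZl psdZr mulrA.
exact: psd_ge0.
Qed.

(** Its quadratic form is the sum, over the fibres of [f], of the squared sums
of the coefficients in the fibre. *)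
Lemma psd_kernel_eq (Y : eqType) (f : X -> Y) :
  psd_kernel (fun x y => (f x == f y)%:R).
Proof.
split=> [x y|s c us]; first by rewrite eq_sym.
pose t := undup (map f s).
have -> : quad s (fun x y => (f x == f y)%:R) c =
    \sum_(z <- t) quad s (fun x y => (f x == z)%:R * (f y == z)%:R) c.
  rewrite exchange_big; apply: eq_big_seq => i si.
  rewrite exchange_big; apply: eq_bigr => j _ /=.
  rewrite -mulr_sumr; congr (_ * _).
  rewrite (bigD1_seq (f i)) ?undup_uniq ?mem_undup ?map_f//= eqxx mul1r eq_sym.
  by rewrite big1 ?addr0// => z; rewrite eq_sym => /negbTE ->; rewrite mul0r.
apply: sumr_ge0 => z _.
exact: (psd_kernel_rank1 (fun x => (f x == z)%:R)).2.
Qed.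

(** Expanding the square, the Gaussian kernel is the product of a rank one
kernel and of the exponential of twice the inner product; the exponential
series only involves sums, limits and products of positive definite kernels.
*)
Theorem schoenberg (H : hilbertType R) (v : X -> H) :
  psd_kernel (fun x y => expR (- `|v x - v y| ^+ 2)).
Proof.
have -> : (fun x y => expR (- `|v x - v y| ^+ 2)) =
    (fun x y => expR (- `|v x| ^+ 2) * expR (- `|v y| ^+ 2) *
                expR (2 * inner_form H (v x) (v y))).
  apply/funext => x; apply/funext => y; rewrite -!expRD; congr expR.
  by rewrite sqr_normB !sqr_norm_inner /=; lra.
apply: psd_kernelM; first exact: psd_kernel_rank1.
apply: psd_kernel_expR; apply: psd_kernelZ => //.
exact: psd_kernel_form.
Qed.

End kernels.

(** * Representations from invariant kernels *)

Section free_module.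
Context (R : realType) (X : choiceType).
Implicit Types (c d : {freeg X / R}) (x y : X).

Section linear_extension.
Context (V : lmodType R) (f : X -> V).

Lemma fgliftE c : fglift f c = \sum_(x <- dom c) coeff x c *: f x.
Proof.
pose F : {additive {freeg X / R} -> V} :=
  HB.pack (fglift f) (GRing.isZmodMorphism.Build _ _ _ (lift_is_additive f)).
rewrite -[in LHS](freeg_sumE c) -[LHS]/(F _) raddf_sum.
by apply: eq_bigr => x _; exact: liftU.
Qed.

Lemma fgliftP a c d : fglift f (a *: c + d) = a *: fglift f c + fglift f d.
Proof.
pose F : {additive {freeg X / R} -> V} :=
  HB.pack (fglift f) (GRing.isZmodMorphism.Build _ _ _ (lift_is_additive f)).
rewrite -[LHS]/(F _) raddfD /= -[X in X + _]/(F (fgscale a c)) raddf_sum.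
congr (_ + _); rewrite fgliftE scaler_sumr.
by apply: eq_bigr => x _; rewrite /= liftU scalerA.
Qed.

End linear_extension.

Lemma fglift_id c : fglift (fun x => << x >> : {freeg X / R}) c = c.
Proof.
rewrite fgliftE -[RHS]freeg_sumE; apply: eq_bigr => x _.
by apply/eqP/freeg_eqP => y; rewrite coeffZ !coeffU mul1r.
Qed.

Lemma fglift_comp (V W : lmodType R) (L : V -> W) (f : X -> V) c :
  (forall a u v, L (a *: u + v) = a *: L u + L v) ->
  L (fglift f c) = fglift (L \o f) c.
Proof.
move=> LP; rewrite !fgliftE.
have L0 : L 0 = 0.
  by have := LP (-1) 0 0; rewrite scaler0 addr0 scaleN1r addNr.
elim: (dom c) => [|x s IH]; first by rewrite !big_nil.
by rewrite !big_cons LP IH.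
Qed.

End free_module.

Section kernel_form.
Context (R : realType) (X : choiceType) (K : X -> X -> R).
Hypothesis psdK : psd_kernel K.
Implicit Types (c d e : {freeg X / R}).

Definition free_form c d : R :=
  fglift (fun x => fglift (fun y => K x y : R^o) d : R^o) c.

Lemma free_formE c d : free_form c d =
  \sum_(x <- dom c) \sum_(y <- dom d) coeff x c * coeff y d * K x y.
Proof.
rewrite /free_form fgliftE; apply: eq_bigr => x _.
rewrite fgliftE scaler_sumr; apply: eq_bigr => y _.
by rewrite -mulrA.
Qed.

Fact free_formC c d : free_form c d = free_form d c.
Proof.
rewrite !free_formE exchange_big; apply: eq_bigr => y _; apply: eq_bigr => x _.
by rewrite (proj1 psdK) [coeff _ _ * coeff _ _]mulrC.
Qed.

Fact free_formP a c d e :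
  free_form (a *: c + d) e = a * free_form c e + free_form d e.
Proof. exact: fgliftP. Qed.

Fact free_form_ge0 c : 0 <= free_form c c.
Proof.
rewrite free_formE.
exact: (proj2 psdK (dom c) (fun x => coeff x c) (uniq_dom c)).
Qed.

Definition kernel_form : psd_form {freeg X / R} :=
  PsdForm free_formC free_formP free_form_ge0.

Lemma kernel_formU x y : kernel_form << x >> << y >> = K x y.
Proof. by rewrite /= /free_form !liftU !scale1r. Qed.

End kernel_form.

Section kernel_action.
Context (R : realType) (G : groupType) (X : choiceType) (a : G -> X -> X).
Hypotheses (a1 : forall x, a 1%g x = x)
  (aM : forall g h x, a (g * h)%g x = a g (a h x)).

Definition free_act_fun g : {freeg X / R} -> {freeg X / R} :=
  fglift (fun x => << a g x >>).

Fact free_actP g b c d :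
  free_act_fun g (b *: c + d) = b *: free_act_fun g c + free_act_fun g d.
Proof. exact: fgliftP. Qed.

Lemma free_actU g x : free_act_fun g << x >> = << a g x >>.
Proof. by rewrite /free_act_fun liftU scale1r. Qed.

Fact free_act1 c : free_act_fun 1%g c = c.
Proof.
by rewrite -[RHS]fglift_id; congr fglift; apply/funext => x; rewrite a1.
Qed.

Fact free_actM g h c :
  free_act_fun (g * h)%g c = free_act_fun g (free_act_fun h c).
Proof.
rewrite [RHS](@fglift_comp _ _ _ _ (free_act_fun g)); last exact: free_actP.
by congr fglift; apply/funext => x /=; rewrite free_actU aM.
Qed.

Definition free_act := LinearAction free_actP free_act1 free_actM.

Context (K : X -> X -> R) (psdK : psd_kernel K).
Hypothesis aK : forall g x y, K (a g x) (a g y) = K x y.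

Lemma free_act_isometric : isometric free_act (kernel_form psdK).
Proof.
move=> g c d; rewrite [RHS]free_formE.
rewrite [free_act g c]fgliftE [free_act g d]fgliftE psdC psd_sumr.
apply: eq_bigr => x _; rewrite psdZr psdC psd_sumr mulr_sumr.
by apply: eq_bigr => y _; rewrite psdZr kernel_formU aK mulrA.
Qed.

(** The Gelfand-Naimark-Segal construction: the free module on [X] with the
bilinear extension of [K] as form and the linear extension of the action. *)
Theorem invariant_kernel_representation :
  exists (H : hilbertType R) (pi : G -> {linear H -> H}) (v : X -> H),
    [/\ orthogonal_representation pi, forall g x, pi g (v x) = v (a g x) &
        forall x y, inner (v x) (v y) = K x y].
Proof.
exists (completion (kernel_form psdK)), (completion_rep free_act_isometric).
exists (fun x => embedding _ << x >>); split.
- exact: completion_rep_orthogonal.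
- by move=> g x; rewrite completion_rep_embedding /= free_actU.
- by move=> x y; rewrite inner_completionE inner_embedding kernel_formU.
Qed.

End kernel_action.

(** * A proper cocycle contradicts relative Property T *)

Section proper_orbits.
Context (R : realType) (G : groupType) (T : set G).
Hypotheses (finT : finite_set T) (genT : generates T).

Lemma infinite_set_far (Y : set G) (m : nat) : infinite_set Y ->
  exists2 y, Y y & m%:R <= word_length R T y.
Proof.
move=> infY; apply: contrapT => /forall2NP near0; apply: infY.
apply: sub_finite_set (finite_word_ball m finT) => y Yy.
have [w [Tw lw _]] := word_length_spec R (genT y); exists w => //.
have [//|/negP] := near0 y; rewrite lw ler_nat -ltnNge => /ltnW //.
Qed.

Lemma proper_function_large (rho : R -> R) (a : R) : proper_function rho ->
  exists m : nat, forall t, m%:R <= t -> a < rho t.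
Proof.
move=> [rho0 rhoP].
have bA : bounded_set (`[0, a]%classic : set R).
  exists a; split=> [|M aM x /=]; first exact: num_real.
  rewrite in_itv/= => /andP[x0 xa].
  by rewrite ger0_norm// (le_trans xa)// ltW.
have [M [_ Mrho]] := rhoP _ bA.
exists (Num.bound `|M + 1|) => t mt.
have Mt : M + 1 < t.
  by rewrite (lt_le_trans _ mt)// (le_lt_trans (ler_norm _))// archi_boundP.
have t0 : 0 <= t by rewrite (le_trans _ mt).
rewrite ltNge; apply/negP => rt.
have : `|t| <= M + 1.
  by apply: Mrho; [rewrite ltrDl|split=> //=; rewrite in_itv/= rt rho0].
by rewrite ger0_norm// leNgt Mt.
Qed.

End proper_orbits.

(** All the rescaled cocycles [tau k *: b] are used at once, on the index set
[nat * G]. The factor [i.1 == j.1] makes the vectors of different levels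
orthogonal; without it the kernel would not be invariant, because translations
act at level [k] through the affine action with cocycle [tau k *: b]. *)
Theorem haagerup_not_relative_T (R : realType) (G : groupType) (Y : set G) :
  infinite_set Y -> haagerup R G -> ~ relative_property_T R Y.
Proof.
move=> infY [T [finT genT [H [pi [b [piP npi bM [rho [gamma]]]]]]]].
move=> [rhoP gammaP b_bounds] relT.
pose tau k : R := k.+1%:R^-1.
have tau0 k : 0 < tau k by rewrite invr_gt0.
pose orbit (i : nat * G) : H := tau i.1 *: b i.2.
pose K (i j : nat * G) : R :=
  (i.1 == j.1)%:R * expR (- `|orbit i - orbit j| ^+ 2).
have psdK : psd_kernel K.
  by apply: psd_kernelM; [exact: psd_kernel_eq|exact: schoenberg].
pose a g (i : nat * G) := (i.1, (g * i.2)%g).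
have a1 i : a 1%g i = i by case: i => k g; rewrite /a mul1g.
have aM g h i : a (g * h)%g i = a g (a h i) by rewrite /a mulgA.
have aK g i j : K (a g i) (a g j) = K i j.
  rewrite /K /=; have [ij|_] := eqVneq i.1 j.1; last by rewrite !mul0r.
  rewrite /orbit /= ij -!scalerBr !bM opprD addrACA subrr addr0 -linearB.
  by rewrite !normrZ npi.
have [H' [pi' [v [pi'P pi'v vK]]]] :=
  invariant_kernel_representation a1 aM psdK aK.
pose u k := v (k, 1%g).
have u1 k : `|u k| = 1.
  apply/eqP; rewrite -(@eqrXn2 _ 2)// sqr_norm_inner vK /K eqxx mul1r.
  by rewrite subrr normr0 expr0n oppr0 expR0 expr1n.
have disp g k : `|pi' g (u k) - u k| ^+ 2 =
    2 - 2 * expR (- (tau k * `|b g - b 1%g|) ^+ 2).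
  rewrite sqr_normB /u pi'v !vK /K /a /= !eqxx !mul1r mulg1 !subrr !normr0.
  rewrite /orbit /= -scalerBr normrZ ger0_norm ?ltW//.
  by rewrite expr0n oppr0 expR0; lra.
have u_inv g : `|pi' g (u n) - u n| @[n --> \oo] --> (0 : R).
  apply/cvgr0Pnorm_le => e e0; near=> k.
  rewrite normr_id -ler_sqr ?nnegrE//; last exact: ltW.
  rewrite disp.
  set c := `|b g - b 1%g|.
  have c0 : 0 <= c by exact: normr_ge0.
  have ck : tau k * c <= e / 2.
    rewrite ler_pdivrMl// -ler_pdivrMr ?divr_gt0//.
    have Nk : (Num.bound (c / (e / 2)) <= k.+1)%N.
      by near: k; exists (Num.bound (c / (e / 2))) => // n /= /leqW.
    rewrite (le_trans (ltW (archi_boundP _))) ?ler_nat//.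
    by apply: divr_ge0 => //; rewrite divr_ge0// ltW.
  (* Since [1 - x <= exp (- x)], the squared displacement is at most [2
     (tau k * c)^2]. *)
  have : (tau k * c) ^+ 2 <= (e / 2) ^+ 2.
    by rewrite lerXn2r ?nnegrE ?mulr_ge0 ?divr_ge0 ?(ltW (tau0 _)) ?(ltW e0).
  have := expR_ge1Dx (- (tau k * c) ^+ 2); have := sqr_ge0 e.
  by rewrite expr_div_n; lra.
have big_y k : exists2 y, Y y & 1 <= `|pi' y (u k) - u k|.
  have [m mrho] := proper_function_large k.+1%:R rhoP.
  have [y Yy my] := infinite_set_far R finT genT m infY.
  exists y => //; rewrite -ler_sqr ?nnegrE// expr1n disp.
  have /andP[rb _] := b_bounds tt 1%g y.
  have : k.+1%:R < `|b y - b 1%g|.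
    rewrite distrC; apply: lt_le_trans rb; apply: mrho.
    by rewrite /word_metric invg1 mul1g.
  move=> /ltW far.
  have {}far : 1 <= tau k * `|b y - b 1%g| by rewrite ler_pdivlMl// mulr1.
  have x1 : 1 <= (tau k * `|b y - b 1%g|) ^+ 2 by exact: exprn_ege1.
  set x := (_ ^+ 2) in x1 *.
  have e2 : expR (- x) <= 2^-1.
    rewrite expRN lef_pV2 ?posrE ?expR_gt0//.
    by rewrite (le_trans _ (expR_ge1Dx x))// -[2]/(1 + 1) lerD2l.
  by move: e2; lra.
have := relT H' pi' pi'P u u1 u_inv.
move=> /(@cvgr_to_ge _ _ _ _ _ _ 1) ge1.
suff : 1 <= 0 :> R by rewrite ler10.
apply: ge1; near=> k.
have [y Yy /le_trans] := big_y k; apply; apply: ub_le_sup; last by exists y.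
exists 2 => _ [z _ <-]; rewrite (le_trans (ler_normB _ _))//.
by rewrite (orthogonal_norm_preserving pi'P) u1.
Unshelve. all: by end_near. Qed.

Theorem corollary1p1 (R : realType) (G : groupType) (S : set G)
    (finS : finite_set S) (genS : generates S) :
  (~ haagerup R G ->
   forall N : nat -> normalClosed G, box_filtration N ->
     ~ coarsely_embeds_in_Hilbert (box_metric R S N)) /\
  ((exists Y : set G, infinite_set Y /\ relative_property_T R Y) ->
   forall N : nat -> normalClosed G, box_filtration N ->
     ~ coarsely_embeds_in_Hilbert (box_metric R S N)).
Proof.
split=> [nH N boxN /(haagerup_box finS genS boxN)//|].
move=> [Y [infY relT]] N boxN /(haagerup_box finS genS boxN) GH.
exact: (haagerup_not_relative_T infY GH relT).
Qed.
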